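(* Let $G=(V,E,w)$ be a finite graph with $E\subseteq V\times V$ and nonnegative edge weights $w\in\mathbb{R}_+^E$, let $f:\mathbb{R}^V\to\mathbb{R}$ be differentiable, for each $v\in V$ let $g_v:\mathbb{R}\to\,]-\infty,+\infty]$ be directionally differentiable, and let $$F:\mathbb{R}^V\to\,]-\infty,+\infty],\qquad F(x)=f(x)+\sum_{v\in V}g_v(x_v)+\sum_{(u,v)\in E}w_{(u,v)}|x_u-x_v| .$$ Let $x\in\operatorname{dom}F$. If $F$ admits a strict descent direction at point $x$, then $F$ admits at $x$ a strict descent direction in the set $\{-1,0,+1\}^V$.
   Context: For a real vector space $\Omega$ and $h:\Omega\to\,]-\infty,+\infty]$, $\operatorname{dom}h=\{x\in\Omega\mid h(x)<+\infty\}$. For $x\in\operatorname{dom}h$ and $d\in\Omega$, $h$ admits a directional derivative at $x$ in direction $d$ if $h'(x,d)=\lim_{t\downarrow0}\frac{h(x+td)-h(x)}{t}$ exists in $]-\infty,+\infty]$. $h$ is directionally differentiable if this holds at every point of its domain and in every direction. (Under the hypotheses of the claim, $F$ is directionally differentiable.) A strict descent direction for $F$ at $x\in\operatorname{dom}F$ is a vector $d\in\mathbb{R}^V$ such that $F'(x,d)<0$. *)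

(* Defs.v *)
From HB Require Import structures.
From mathcomp Require Import all_boot all_order all_algebra.
From mathcomp Require Import all_classical all_reals all_analysis.

Set Implicit Arguments.
Unset Strict Implicit.
Unset Printing Implicit Defensive.

Import Order.TTheory GRing.Theory Num.Theory.
Import numFieldNormedType.Exports.

Local Open Scope classical_set_scope.
Local Open Scope ring_scope.

(* Functions into ]-oo, +oo] are represented as functions into \bar R that
   never take the value -oo; the latter condition is stated separately. *)

Definition dom (R : realType) (W : lmodType R) (h : W -> \bar R) : set W :=
  [set x | (h x < +oo)%E].

(* Meaningful for x in dom h, where h x is finite. *)
Definition dir_quotient (R : realType) (W : lmodType R) (h : W -> \bar R)
    (x d : W) (t : R) : \bar R :=
  ((t^-1)%:E * (h (x + t *: d)%R - h x))%E.

(* The limit is taken in the extended reals: +oo is allowed, -oo is not. *)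
Definition has_dir_deriv (R : realType) (W : lmodType R) (h : W -> \bar R)
    (x d : W) : Prop :=
  exists2 l : \bar R, l != -oo%E & dir_quotient h x d t @[t --> 0^'+] --> l.

Definition dir_deriv (R : realType) (W : lmodType R) (h : W -> \bar R)
    (x d : W) : \bar R :=
  lim (dir_quotient h x d t @[t --> 0^'+]).

Definition directionally_differentiable (R : realType) (W : lmodType R)
    (h : W -> \bar R) : Prop :=
  forall x, dom h x -> forall d, has_dir_deriv h x d.

Definition strict_descent_direction (R : realType) (W : lmodType R)
    (h : W -> \bar R) (x d : W) : Prop :=
  [/\ dom h x, has_dir_deriv h x d & (dir_deriv h x d < 0)%E].

(* R^V for a finite type V is the normed space of row vectors indexed by
   'I_#|V|; the coordinate at v is the one of index enum_rank v. *)
Definition coordV (R : realType) (V : finType) (x : 'rV[R]_#|V|) (v : V) : R :=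
  x ord0 (enum_rank v).

Definition graph_objective (R : realType) (V : finType) (E : {set V * V})
    (w : V * V -> R) (f : 'rV[R]_#|V| -> R) (g : V -> R -> \bar R)
    (x : 'rV[R]_#|V|) : \bar R :=
  ((f x)%:E + \sum_(v : V) g v (coordV x v)
   + (\sum_(e in E) w e * `|coordV x e.1 - coordV x e.2|)%R%:E)%E.

(* Main.v *)
(** The directional derivative [Phi d] of [F] at [x] is the sum of a linear
    part (from [f]), of positively homogeneous functions of single coordinates
    (from the [g v]), and of functions of differences [d_u - d_v] which are
    linear if [x_u != x_v] and a multiple of the absolute value otherwise.
    Let [s] be the vector of signs of [d] and [m] the smallest [`|d_v|] over
    the nonzero coordinates. Subtracting [m s] from [d] reverses neither the
    sign of a coordinate nor the order of two coordinates, so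
    [Phi d = m Phi s + Phi (d - m s)], and [d - m s] has smaller support. By
    induction, [Phi] is nonnegative everywhere if it is on sign vectors. *)

Require Import Defs.
From HB Require Import structures.
From mathcomp Require Import all_boot all_order all_algebra.
From mathcomp Require Import all_classical all_reals all_analysis.
From mathcomp Require Import lra.

Import Order.TTheory GRing.Theory Num.Theory.
Import numFieldNormedType.Exports.

Local Open Scope classical_set_scope.
Local Open Scope ring_scope.

(** * Calculus of one-sided directional derivatives with values in the extended reals *)

Definition dir_cvg {R : realType} {W : lmodType R} (h : W -> \bar R)
    (x d : W) (l : \bar R) : Prop :=
  dir_quotient h x d t @[t --> 0^'+] --> l.

Lemma dir_cvgP [R : realType] [W : lmodType R] [h : W -> \bar R]
    [x d : W] [l : \bar R] :
  dir_cvg h x d l -> dir_deriv h x d = l.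
Proof. by move=> hl; apply: cvg_lim. Qed.

Lemma has_dir_deriv_cvg [R : realType] [W : lmodType R] [h : W -> \bar R]
    [x d : W] :
  has_dir_deriv h x d ->
  dir_deriv h x d != -oo%E /\ dir_cvg h x d (dir_deriv h x d).
Proof. by move=> [l lNy hl]; rewrite (dir_cvgP hl). Qed.

(** With [h1 x] and [h2 x] finite, the only infinite values that can occur are [+oo] at
    [x + t *: d]. Both increments are then different from [-oo], so distributivity never meets
    [oo - oo]. *)
Lemma dir_quotientD {R : realType} {W : lmodType R} (h1 h2 : W -> \bar R)
    (x d : W) (t : R) :
  (forall y, h1 y != -oo%E) -> (forall y, h2 y != -oo%E) ->
  h1 x \is a fin_num -> h2 x \is a fin_num ->
  dir_quotient (fun y => h1 y + h2 y)%E x d t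
  = (dir_quotient h1 x d t + dir_quotient h2 x d t)%E.
Proof.
move=> h1Ny h2Ny; rewrite /dir_quotient => /fineK <- /fineK <-.
move: (fine (h1 x)) (fine (h2 x)) => a b.
have := h1Ny (x + t *: d); have := h2Ny (x + t *: d).
case: (h1 _) => [r1||] //; case: (h2 _) => [r2||] // _ _;
  rewrite -muleDr //=; congr (_ * _)%E.
by rewrite -!EFinD; congr (_%:E); lra.
Qed.

Lemma dir_cvgD {R : realType} {W : lmodType R} (h1 h2 : W -> \bar R)
    (x d : W) (l1 l2 : \bar R) :
  (forall y, h1 y != -oo%E) -> (forall y, h2 y != -oo%E) ->
  h1 x \is a fin_num -> h2 x \is a fin_num ->
  l1 != -oo%E -> l2 != -oo%E ->
  dir_cvg h1 x d l1 -> dir_cvg h2 x d l2 ->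
  dir_cvg (fun y => h1 y + h2 y)%E x d (l1 + l2)%E.
Proof.
move=> h1Ny h2Ny h1x h2x l1Ny l2Ny h1l h2l; rewrite /dir_cvg.
under eq_fun do rewrite dir_quotientD//.
by apply: cvgeD => //; case: l1 l2 l1Ny l2Ny {h1l h2l} => [?||] [?||].
Qed.

Lemma dir_cvg_cst0 {R : realType} {W : lmodType R} (x d : W) :
  dir_cvg (fun=> 0%E) x d 0%E.
Proof.
rewrite /dir_cvg /dir_quotient sube0.
by under eq_fun do rewrite mule0; exact: cvg_cst.
Qed.

Lemma sume_neqNy {R : realType} {I : eqType} (r : seq I) (P : pred I)
    (F : I -> \bar R) :
  (forall i, F i != -oo%E) -> (\sum_(i <- r | P i) F i)%E != -oo%E.
Proof.
move=> FNy; apply/eqP => /esum_eqNyP[i [_ _ /eqP]].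
by rewrite (negbTE (FNy i)).
Qed.

Lemma dir_cvg_sum {R : realType} {W : lmodType R} {I : eqType}
    (r : seq I) (P : pred I) (h : I -> W -> \bar R) (x d : W)
    (l : I -> \bar R) :
  (forall i y, h i y != -oo%E) -> (forall i, h i x \is a fin_num) ->
  (forall i, l i != -oo%E) -> (forall i, P i -> dir_cvg (h i) x d (l i)) ->
  dir_cvg (fun y => \sum_(i <- r | P i) h i y)%E x d
    (\sum_(i <- r | P i) l i)%E.
Proof.
move=> hNy hx lNy hl; elim: r => [|i r IH].
  rewrite big_nil (_ : (fun y => _) = fun=> 0%E); first exact: dir_cvg_cst0.
  by apply/funext => y; rewrite big_nil.
rewrite big_cons; have -> : (fun y => \sum_(j <- i :: r | P j) h j y)%E
    = fun y => (if P i then h i y + \sum_(j <- r | P j) h j y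
                else \sum_(j <- r | P j) h j y)%E.
  by apply/funext => y; rewrite big_cons.
case: ifP => // Pi; apply: dir_cvgD => //; try exact: hl;
  try (by move=> *; apply: sume_neqNy).
by rewrite sum_fin_num; apply/allP => /= z /mapP[? _ ->].
Qed.

Lemma dir_cvg0 {R : realType} {W : lmodType R} (h : W -> \bar R) (x : W) :
  h x \is a fin_num -> dir_cvg h x 0 0%E.
Proof.
move=> hx; rewrite /dir_cvg /dir_quotient.
under eq_fun do rewrite scaler0 addr0 subee// mule0.
exact: cvg_cst.
Qed.

(** Substitute [t * s] for [t]: the quotient along [s *: d] at [t] is [s] times the quotient along
    [d] at [t * s], and [t * s] tends to [0] from the right because [s > 0]. *)
Lemma dir_cvgZ {R : realType} {W : lmodType R} (h : W -> \bar R) (x d : W)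
    (s : R) (l : \bar R) : 0 < s ->
  dir_cvg h x d l -> dir_cvg h x (s *: d) (s%:E * l)%E.
Proof.
move=> s0 hl; rewrite /dir_cvg.
have -> : dir_quotient h x (s *: d)
    = (fun t => s%:E * dir_quotient h x d (t * s))%E.
  apply/funext => t; rewrite /dir_quotient scalerA muleA -EFinM invfM.
  by rewrite mulrCA divff ?gt_eqF// mulr1.
apply: cvgeZl => //.
suff : t * s @[t --> 0^'+] --> 0^'+ by move=> /cvg_comp; apply.
move=> A [e /= e0 eA]; exists (e / s); first by rewrite /= divr_gt0.
move=> t /= te t0; apply: eA; rewrite ?mulr_gt0//=.
by move: te; rewrite !sub0r !normrN normrM (gtr0_norm s0) ltr_pdivlMr.
Qed.

(** * Derivatives of the smooth term and of the absolute values *)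

Lemma dir_cvg_diff {R : realType} {W : normedModType R} (f : W -> R) (x d : W) :
  differentiable f x -> dir_cvg (fun y => (f y)%:E) x d ('d f x d)%:E.
Proof.
move=> fx; rewrite -deriveE//; have := diff_derivable (v := d) fx.
move=> /cvg_dnbhs_at_right fd.
apply: cvg_EFin; first by near=> t.
apply: cvg_trans fd; apply: near_eq_cvg; near=> t.
by rewrite /dir_quotient /= [t *: d + x]addrC.
Unshelve. all: end_near.
Qed.

(* The one-sided derivative at [0] of [t |-> `|a + t * b|]. *)
Definition abs_slope {R : realType} (a b : R) : R :=
  if a == 0 then `|b| else Num.sg a * b.

(** The quotient is constant for small [t > 0]. If [k x = 0], this is homogeneity of the absolute
    value; otherwise [k x + t * k d] keeps the sign of [k x] as long as [|t * k d| < |k x|]. *)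
Lemma dir_cvg_abs {R : realType} {W : lmodType R} (c : R)
    (k : W -> R) (x d : W) :
  (forall t, k (x + t *: d) = k x + t * k d) ->
  dir_cvg (fun y => (c * `|k y|)%:E) x d (c * abs_slope (k x) (k d))%:E.
Proof.
move=> kD; apply: cvg_near_cst.
have quotE t : dir_quotient (fun y => (c * `|k y|)%:E) x d t
    = (c * (t^-1 * (`|k x + t * k d| - `|k x|)))%:E.
  by rewrite /dir_quotient -EFinB -EFinM kD -mulrBr mulrCA.
rewrite /abs_slope; have [kx0|kx0] := eqVneq (k x) 0.
  near=> t; have t0 : 0 < t by near: t; exact: nbhs_right_gt.
  by rewrite quotE kx0 add0r normr0 subr0 normrM gtr0_norm// mulKf ?gt_eqF.
(* The added [1] keeps the denominator of the bound on [t] positive even when [k d = 0]. *)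
have kd1 : 0 < `|k d| + 1 by rewrite ltr_wpDl.
have q0 : 0 < `|k x| / (`|k d| + 1) by rewrite divr_gt0 ?normr_gt0.
near=> t; have t0 : 0 < t by near: t; exact: nbhs_right_gt.
have : t < `|k x| / (`|k d| + 1) by near: t; exact: nbhs_right_lt.
rewrite ltr_pdivlMr// => tlt.
have : `|t * k d| < `|k x|.
  rewrite normrM (gtr0_norm t0); apply: le_lt_trans tlt.
  by rewrite ler_pM2l// lerDl.
rewrite quotE => tkd; congr (c * _)%:E.
(* Multiplying by [t] clears the inverse; what remains is piecewise linear in [a = k x] and
   [b = t * k d], with the sign of [a + b] forced by that of [a]. *)
apply: (mulfI (lt0r_neq0 t0)); rewrite mulVKf ?gt_eqF//.
rewrite mulrCA; move/ltr_normlP: tkd; move: (t * k d) (k x) kx0 => b a + [].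
case: (sgrP a) => // a0 _; case: (ger0P (a + b)); lra.
Unshelve. all: end_near.
Qed.

(** * Splitting off a multiple of the sign vector *)

Lemma pos_homog_split {R : realType} (G : R -> \bar R) (s m : R) :
  G 0 = 0%E -> (forall a b, 0 < a -> G (a * b) = (a%:E * G b)%E) ->
  0 <= m -> (s != 0 -> m <= `|s|) ->
  G s = (m%:E * G (Num.sg s) + G (s - m * Num.sg s)%R)%E.
Proof.
move=> G0 Gpos m0 ms.
(* The factor [0] must be covered too, since [|s| - m] may vanish; there [G 0 = 0] matches the
   convention [0 * +oo = 0]. *)
have Gge0 a b : 0 <= a -> G (a * b) = (a%:E * G b)%E.
  by rewrite le_eqVlt => /predU1P[<-|/Gpos//]; rewrite mul0r G0 mul0e.
have [->|s0] := eqVneq s 0; first by rewrite sgr0 mulr0 subr0 G0 mule0 adde0.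
have {}ms := ms s0.
(* All three arguments of [G] are nonnegative multiples of [Num.sg s], with factors
   [|s| = m + (|s| - m)]. *)
have -> : s - m * Num.sg s = (`|s| - m) * Num.sg s by rewrite {1}[s]numEsg; lra.
rewrite (Gge0 (`|s| - m)) ?subr_ge0// -ge0_muleDl ?lee_fin ?subr_ge0//.
by rewrite -EFinD subrKC -Gge0// mulrC -numEsg.
Qed.

(** For [a != 0] both sides are linear. For [a = 0], the two differences on the right never have
    opposite strict signs, so their absolute values add up. *)
Lemma abs_slope_split {R : realType} (a s1 s2 m : R) :
  0 <= m -> (s1 != 0 -> m <= `|s1|) -> (s2 != 0 -> m <= `|s2|) ->
  abs_slope a (s1 - s2) = m * abs_slope a (Num.sg s1 - Num.sg s2)
    + abs_slope a ((s1 - m * Num.sg s1) - (s2 - m * Num.sg s2)).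
Proof.
move=> m0 ms1 ms2; rewrite /abs_slope; case: ifP => _; last lra.
move: ms1 ms2; case: (sgrP s1) => [->|s1p|s1n] /=;
  case: (sgrP s2) => [->|s2p|s2n] /= ms1 ms2;
  rewrite ?eqxx ?gt_eqF ?lt_eqF// in ms1 ms2;
  try have {}ms1 := ms1 isT; try have {}ms2 := ms2 isT;
  do !case: ger0P => ?; lra.
Qed.

(** Induction on the number of nonzero coordinates, with [m] the smallest of their absolute values:
    zero coordinates stay zero because [Num.sg 0 = 0], and the coordinate attaining the minimum
    becomes zero. *)
Lemma layer_ind {R : realType} {n : nat} (P : 'rV[R]_n -> Prop) :
  P 0 ->
  (forall (d : 'rV[R]_n) (m : R), 0 < m ->
     (forall i, d ord0 i != 0 -> m <= `|d ord0 i|) ->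
     P (d - m *: map_mx Num.sg d) -> P d) ->
  forall d, P d.
Proof.
move=> P0 PS d.
have [k] := ubnP #|[pred i | d ord0 i != 0]|; elim: k d => // k IH d.
rewrite ltnS => dk; have [d0|dn0] := eqVneq d 0; first by rewrite d0.
have /rV0Pn[i0 di0] := dn0.
case: (@arg_minP _ _ _ i0 (fun i => d ord0 i != 0) (fun i => `|d ord0 i|) di0).
move=> i di imin; apply: (PS _ `|d ord0 i|); rewrite ?normr_gt0//.
apply: IH; apply: leq_trans dk; apply: proper_card; apply/properP; split.
  apply/fintype.subsetP => j; rewrite !inE; apply: contraNneq => dj0.
  by rewrite !mxE dj0 sgr0 mulr0 subr0.
exists i; rewrite !inE// negbK !mxE.
by rewrite [X in X - _]numEsg mulrC subrr.
Qed.

(** * The directional derivative of the objective and its splitting *)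

Definition graph_slope {R : realType} {V : finType} (E : {set V * V})
    (w : V * V -> R) (f : 'rV[R]_#|V| -> R) (g : V -> R -> \bar R)
    (x d : 'rV[R]_#|V|) : \bar R :=
  (('d f x d)%:E
   + \sum_(v : V) dir_deriv (g v : R^o -> \bar R) (coordV x v) (coordV d v)
   + (\sum_(e in E) w e * abs_slope (coordV x e.1 - coordV x e.2)
                                     (coordV d e.1 - coordV d e.2))%R%:E)%E.

(** As no summand is [-oo], a single [+oo] among the [g v] would make the whole objective [+oo]. *)
Lemma graph_objective_dom_fin_num [R : realType] [V : finType]
    [E : {set V * V}] [w : V * V -> R] [f : 'rV[R]_#|V| -> R]
    [g : V -> R -> \bar R] [x : 'rV[R]_#|V|] :
  (forall v r, g v r != -oo%E) -> dom (graph_objective E w f g) x ->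
  forall v, g v (coordV x v) \is a fin_num.
Proof.
move=> gNy xdom v; rewrite fin_numE gNy /=; apply/eqP => gy.
have : (\sum_(v : V) g v (coordV x v) = +oo)%E.
  by apply/esum_eqyP => //; exists v; rewrite mem_index_enum.
by move: xdom; rewrite /dom /graph_objective /= => /[swap] ->.
Qed.

Lemma graph_slope_neqNy {R : realType} {V : finType} (E : {set V * V})
    (w : V * V -> R) (f : 'rV[R]_#|V| -> R) (g : V -> R -> \bar R)
    (x d : 'rV[R]_#|V|) :
  (forall v s, has_dir_deriv (g v : R^o -> \bar R) (coordV x v) s) ->
  graph_slope E w f g x d != -oo%E.
Proof.
move=> gd; rewrite /graph_slope !adde_eq_ninfty !negb_or /= andbT.
by apply: sume_neqNy => v; case: (has_dir_deriv_cvg (gd v (coordV d v))).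
Qed.

Lemma graph_objective_cvg {R : realType} {V : finType} (E : {set V * V})
    (w : V * V -> R) (f : 'rV[R]_#|V| -> R) (g : V -> R -> \bar R)
    (x d : 'rV[R]_#|V|) :
  (forall v r, g v r != -oo%E) -> (forall v, g v (coordV x v) \is a fin_num) ->
  differentiable f x ->
  (forall v s, has_dir_deriv (g v : R^o -> \bar R) (coordV x v) s) ->
  dir_cvg (graph_objective E w f g) x d (graph_slope E w f g x d).
Proof.
move=> gNy gx fx gd.
have gdNy v :
    dir_deriv (g v : R^o -> \bar R) (coordV x v) (coordV d v) != -oo%E.
  by case: (has_dir_deriv_cvg (gd v (coordV d v))).
have sgx : (\sum_(v : V) g v (coordV x v))%E \is a fin_num.
  by rewrite sum_fin_num; apply/allP => /= z /mapP[? _ ->].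
apply: dir_cvgD => //.
- by move=> y; rewrite adde_eq_ninfty !negb_or /=; exact: sume_neqNy.
- by rewrite fin_numD.
- by rewrite adde_eq_ninfty !negb_or /=; exact: sume_neqNy.
- apply: dir_cvgD => //; try (by move=> *; exact: sume_neqNy).
    exact: dir_cvg_diff.
  apply: (dir_cvg_sum _ _ (fun v (y : 'rV[R]_#|V|) => g v (coordV y v))) => //.
  move=> v _; have [_] := has_dir_deriv_cvg (gd v (coordV d v)).
  apply: cvg_trans; apply: near_eq_cvg; near=> t.
  by rewrite /dir_quotient /coordV !mxE.
(* The real edge sum becomes a sum of extended reals, so the sum rule applies; each coordinate
   difference is linear, as [dir_cvg_abs] requires. *)
- rewrite -sumEFin; under eq_fun do rewrite -sumEFin.
  apply: (dir_cvg_sum _ _ (fun e (y : 'rV[R]_#|V|) =>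
    (w e * `|coordV y e.1 - coordV y e.2|)%:E)) => //.
  move=> e _.
  apply: (dir_cvg_abs _ (fun y => coordV y e.1 - coordV y e.2)) => t.
  by rewrite /coordV !mxE; lra.
Unshelve. all: end_near.
Qed.

Lemma dir_deriv0 {R : realType} {W : lmodType R} (h : W -> \bar R) (x : W) :
  h x \is a fin_num -> dir_deriv h x 0 = 0%E.
Proof. by move=> /dir_cvg0/dir_cvgP. Qed.

Lemma dir_derivZ {R : realType} {W : lmodType R} (h : W -> \bar R) (x d : W)
    (s : R) :
  0 < s -> has_dir_deriv h x d ->
  dir_deriv h x (s *: d) = (s%:E * dir_deriv h x d)%E.
Proof.
by move=> s0 /has_dir_deriv_cvg[_ hd]; apply: dir_cvgP; exact: dir_cvgZ.
Qed.

Lemma graph_slope_split {R : realType} {V : finType} (E : {set V * V})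
    (w : V * V -> R) (f : 'rV[R]_#|V| -> R) (g : V -> R -> \bar R)
    (x d : 'rV[R]_#|V|) (m : R) :
  differentiable f x -> (forall v, g v (coordV x v) \is a fin_num) ->
  (forall v s, has_dir_deriv (g v : R^o -> \bar R) (coordV x v) s) ->
  0 <= m -> (forall i, d ord0 i != 0 -> m <= `|d ord0 i|) ->
  (graph_slope E w f g x d = m%:E * graph_slope E w f g x (map_mx Num.sg d)
    + graph_slope E w f g x (d - m *: map_mx Num.sg d)%R)%E.
Proof.
move=> fx gx gd m0 md.
have gdNy v s : dir_deriv (g v : R^o -> \bar R) (coordV x v) s != -oo%E.
  by case: (has_dir_deriv_cvg (gd v s)).
have NyD (a b : \bar R) : a != -oo%E -> b != -oo%E -> (a +? b)%E.
  by case: a b => [?||] [?||].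
have sNy (d' : 'rV[R]_#|V|) : (\sum_(v : V)
    dir_deriv (g v : R^o -> \bar R) (coordV x v) (coordV d' v) != -oo)%E.
  exact: sume_neqNy.
(* Distributing [m] is legitimate because no summand is [-oo]; after regrouping, the identity is
   checked term by term. *)
rewrite /graph_slope !muleDr ?NyD ?adde_eq_ninfty ?negb_or ?sNy//.
rewrite [RHS]addeACA [X in _ = (X + _)%E]addeACA; congr (_ + _ + _)%E.
- by rewrite linearB linearZ /= -EFinM -EFinD subrKC.
- rewrite fin_num_sume_distrr//; last by move=> *; exact: NyD.
  rewrite -big_split; apply: eq_bigr => v _ /=.
  rewrite [X in X = _](@pos_homog_split _ _ _ m)//.
  + by rewrite /coordV !mxE.
  + exact: dir_deriv0.
  + by move=> a b a0; exact: dir_derivZ.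
  + exact: md.
- rewrite -EFinM -EFinD mulr_sumr -big_split; congr (_%:E).
  apply: eq_bigr => e _ /=; rewrite /coordV !mxE.
  rewrite (@abs_slope_split _ _ _ _ m)//; [lra|exact: md|exact: md].
Qed.

(** * Existence of a descent direction among sign vectors *)

Theorem proposition2p4 (R : realType) (V : finType) (E : {set V * V})
    (w : V * V -> R) (w_ge0 : forall e, e \in E -> 0 <= w e)
    (f : 'rV[R]_#|V| -> R)
    (f_diff : forall y : 'rV[R]_#|V|, differentiable f y)
    (g : V -> R -> \bar R) (g_gtNy : forall v r, g v r != -oo%E)
    (g_dirdiff : forall v, directionally_differentiable (g v : R^o -> \bar R))
    (x : 'rV[R]_#|V|) (x_dom : dom (graph_objective E w f g) x) :
  (exists d : 'rV[R]_#|V|,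
     strict_descent_direction (graph_objective E w f g) x d) ->
  exists d : 'rV[R]_#|V|,
    (forall v : V, coordV d v \in [:: -1; 0; 1]) /\
    strict_descent_direction (graph_objective E w f g) x d.
Proof.
move=> [d [_ _ Fd]].
have gx := graph_objective_dom_fin_num g_gtNy x_dom.
have gd v s : has_dir_deriv (g v : R^o -> \bar R) (coordV x v) s.
  by apply: g_dirdiff; rewrite /dom /= ltey_eq gx.
have Fcvg d' := graph_objective_cvg E w f g x d' g_gtNy gx (f_diff x) gd.
(* The witness is sought as the sign vector of some [d'], which makes its coordinates lie in
   [{-1, 0, 1}] automatically. *)
suff [d' sd'] : exists d' : 'rV[R]_#|V|,
    (graph_slope E w f g x (map_mx Num.sg d') < 0)%E.
  exists (map_mx Num.sg d'); split.
    by move=> v; rewrite /coordV mxE !inE; case: sgrP; rewrite eqxx ?orbT.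
  split => //; last by rewrite (dir_cvgP (Fcvg _)).
  exists (graph_slope E w f g x (map_mx Num.sg d')).
    exact: graph_slope_neqNy.
  exact: Fcvg.
(* Otherwise the slope is nonnegative on all sign vectors, hence everywhere by [layer_ind], against
   the negative slope along [d]. *)
apply: contrapT => /forallNP nd.
suff /(_ d) : forall d', (0 <= graph_slope E w f g x d')%E.
  by rewrite leNgt -(dir_cvgP (Fcvg d)) Fd.
have sge0 d' : (0 <= graph_slope E w f g x (map_mx Num.sg d'))%E.
  by rewrite leNgt; apply/negP/nd.
apply: layer_ind => [|d' m m0 md IH].
  (* The zero vector is its own sign vector, which settles the base case. *)
  have := sge0 0; rewrite [map_mx _ _](_ : _ = 0)//.
  by apply/rowP => i; rewrite !mxE sgr0.
rewrite (graph_slope_split _ _ _ _ _ _ m) ?(ltW m0)//.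
by rewrite adde_ge0// mule_ge0// lee_fin ltW.
Qed.
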